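(* Let $V\colon\mathbb R^n\times[0,\infty)\to\mathbb R$ be a finite convex function such that $Z(t)=\int_{\mathbb R^n}e^{-V(x,t)}\,dx$ is finite and positive for every $t\ge0$ and $-\log Z(t)=-\log Z(0)+bt$ for every $t\ge0$, for a constant $b$. Then there is a vector $c\in\mathbb R^n$ such that \[ V(x,t)=V(x-tc,0)+bt\qquad\text{for every }x\in\mathbb R^n,\ t\ge0. \]
   Context: Convexity of $V$ means joint convexity in $(x,t)$ on $\mathbb R^n\times[0,\infty)$; $dx$ is Lebesgue measure and $b$ is a real constant. *)

(* Defs.v *)
From HB Require Import structures.
From mathcomp Require Import all_boot all_order all_algebra.
From mathcomp Require Import all_classical all_reals all_analysis.

Set Implicit Arguments.
Unset Strict Implicit.
Unset Printing Implicit Defensive.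

Import Order.TTheory GRing.Theory Num.Theory.
Import numFieldNormedType.Exports.

Local Open Scope classical_set_scope.
Local Open Scope ring_scope.

(* 'rV[T]_n carries the sigma-algebra generated by its n coordinates, as
   n.-tuple T does; for T = R this is the Borel sigma-algebra of R^n. *)
Definition measure_row_display : measure_display -> measure_display.
Proof. exact. Qed.

Section measurable_row.
Context {d} {T : sigmaRingType d}.
Variable n : nat.

Let coors : 'I_n -> 'rV[T]_n -> T := fun i x => x ord0 i.

Let row_set0 : g_sigma_preimage coors set0.
Proof. exact: sigma_algebra0. Qed.

Let row_setC A : g_sigma_preimage coors A -> g_sigma_preimage coors (~` A).
Proof. exact: sigma_algebraC. Qed.

Let row_bigcup (F : _^nat) : (forall i, g_sigma_preimage coors (F i)) ->
  g_sigma_preimage coors (\bigcup_i (F i)).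
Proof. exact: sigma_algebra_bigcup. Qed.

HB.instance Definition _ := @isMeasurable.Build (measure_row_display d)
  'rV[T]_n (g_sigma_preimage coors) row_set0 row_setC row_bigcup.

End measurable_row.

Section row_measurability.
Context d1 d2 (T1 : measurableType d1) (T2 : measurableType d2).

Lemma measurable_row_coord n (i : 'I_n) :
  measurable_fun [set: 'rV[T2]_n] (fun x => x ord0 i).
Proof.
move=> _ Y mY; rewrite setTI; apply: sub_sigma_algebra => /=.
rewrite -bigcup_seq/=; exists i => /=; first by rewrite mem_index_enum.
by exists Y => //; rewrite setTI.
Qed.

Lemma measurable_fun_rowP n (f : T1 -> 'rV[T2]_n) :
  measurable_fun [set: T1] f <->
  forall i, measurable_fun [set: T1] (fun x => f x ord0 i).
Proof.
split=> [mf i|mf].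
  exact: (measurableT_comp (measurable_row_coord i) mf).
apply: measurability; first by [].
move=> _ [A +] <-; rewrite -bigcup_seq => -[i _ [B mB <-]].
rewrite setTI preimage_setI preimage_setT setTI.
by rewrite -[X in measurable X]setTI; exact: mf.
Qed.

End row_measurability.

Section lebesgue_row.
Context {R : realType}.

Definition row_cons n (p : R * 'rV[R]_n) : 'rV[R]_n.+1 :=
  \row_i (if unlift ord0 i is Some j then p.2 ord0 j else p.1).

Definition row_uncons n (x : 'rV[R]_n.+1) : R * 'rV[R]_n :=
  (x ord0 ord0, \row_j x ord0 (lift ord0 j)).

Lemma row_consK n : cancel (@row_cons n) (@row_uncons n).
Proof.
move=> [a x]; rewrite /row_uncons /row_cons mxE unlift_none; congr (_, _).
by apply/rowP => j; rewrite !mxE liftK.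
Qed.

Lemma measurable_row_cons n :
  measurable_fun [set: measurableTypeR R * 'rV[R]_n] (@row_cons n).
Proof.
apply/measurable_fun_rowP => i; case: (unliftP ord0 i) => [j|] ->{i}.
  rewrite (_ : (fun _ => _) = (fun x : 'rV[R]_n => x ord0 j) \o snd).
    by apply: measurableT_comp => //; exact: measurable_row_coord.
  by apply/funext => -[a x] /=; rewrite mxE liftK.
rewrite (_ : (fun _ => _) = fst) //.
by apply/funext => -[a x] /=; rewrite mxE unlift_none.
Qed.

Lemma measurable_row_uncons n :
  measurable_fun [set: 'rV[R]_n.+1]
    (@row_uncons n : _ -> measurableTypeR R * 'rV[R]_n).
Proof.
apply/measurable_fun_pairP; split; first exact: measurable_row_coord.
apply/measurable_fun_rowP => i.
rewrite (_ : (fun _ => _) = fun x : 'rV[R]_n.+1 => x ord0 (lift ord0 i)).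
  exact: measurable_row_coord.
by apply/funext => x /=; rewrite mxE.
Qed.

Section step.
Context n (mu : {sigma_finite_measure set 'rV[R]_n -> \bar R}).

Definition lebesgue_row_step : set 'rV[R]_n.+1 -> \bar R :=
  pushforward (lebesgue_measure \x mu)%E (@row_cons n).

Let mcons := @measurable_row_cons n.

Let step0 : lebesgue_row_step set0 = 0%E.
Proof. exact: measure0. Qed.

Let step_ge0 A : (0 <= lebesgue_row_step A)%E.
Proof. exact: measure_ge0. Qed.

Let step_sigma_additive : semi_sigma_additive lebesgue_row_step.
Proof. exact: (@measure_semi_sigma_additive _ _ _ (pushforward _ _)). Qed.

HB.instance Definition _ := isMeasure.Build _ _ _ lebesgue_row_step
  step0 step_ge0 step_sigma_additive.

Let step_sigma_finite : sigma_finite setT lebesgue_row_step.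
Proof.
have /sigma_finiteP[F [TF ndF Foo]] := sigma_finiteT (@lebesgue_measure R).
have /sigma_finiteP[G [TG ndG Goo]] := sigma_finiteT mu.
exists (fun k => @row_uncons n @^-1` (F k `*` G k)).
  apply/esym; rewrite -subTset => x _; rewrite -preimage_bigcup /=.
  have [k _ Fk] : (\bigcup_k F k) (row_uncons x).1 by rewrite -TF.
  have [l _ Gl] : (\bigcup_k G k) (row_uncons x).2 by rewrite -TG.
  exists (maxn k l) => //; split.
  - by move: Fk; exact/subsetPset/ndF/leq_maxl.
  - by move: Gl; exact/subsetPset/ndG/leq_maxr.
move=> k; have [mF Fk] := Foo k; have [mG Gk] := Goo k; split.
  rewrite -[X in measurable X]setTI.
  by apply: measurable_row_uncons => //; exact: measurableX.
rewrite /lebesgue_row_step /pushforward -comp_preimage.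
rewrite (_ : _ \o _ = id) ?preimage_id; last first.
  by apply/funext; exact: row_consK.
by rewrite product_measure1E// lte_mul_pinfty// ge0_fin_numE.
Qed.

HB.instance Definition _ := Measure_isSigmaFinite.Build _ _ _
  lebesgue_row_step step_sigma_finite.

End step.

(* n-dimensional Lebesgue measure, as the n-fold product of the Lebesgue
   measure on R; on the one-point space R^0 it is the unit point mass. *)
Fixpoint lebesgue_row n : {sigma_finite_measure set 'rV[R]_n -> \bar R} :=
  match n with
  | 0 => \d_(0 : 'rV[R]_0)
  | k.+1 => lebesgue_row_step (lebesgue_row k)
  end.

End lebesgue_row.

Definition partition_function (R : realType) (n : nat)
    (V : 'rV[R]_n * R^o -> R^o) (t : R) : \bar R :=
  (\int[lebesgue_row n]_x (expR (- V (x, t)))%:E)%E.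

(* Main.v *)
Require Import Defs.
From HB Require Import structures.
From mathcomp Require Import all_boot all_order all_algebra.
From mathcomp Require Import all_classical all_reals all_analysis.
From mathcomp Require Import measurable_realfun ring lra.
Set Implicit Arguments.
Unset Strict Implicit.
Unset Printing Implicit Defensive.
Import Order.TTheory GRing.Theory Num.Theory.
Import numFieldNormedType.Exports.
Local Open Scope classical_set_scope.
Local Open Scope ring_scope.

(** Put f (x, t) = V (x, t) - b t. This is convex on the half-space t >= 0, and
    the integral of exp (- f (., t)) is the same positive number Z for all t.
    The claim is that f (x + t c, t) = f (x, 0) for some c.

    It is enough to find c such that f (x + t c, t) <= f (x, 0) for all x and t:
    then exp (- f (. + t c, t)) >= exp (- f (., 0)), both sides have integral Z
    by translation invariance, and both are continuous, so they are equal
    ([eq_continuous_of_integral]). In other words, it is enough that f does not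
    increase in a direction (c, 1), that is, a recession direction.

    Such a direction comes from the behaviour of f at infinity. If f grew at
    least linearly in |(x, t)|, the mass of the slice t would be O(exp (- d t)),
    which contradicts its being Z ([slow_growth_of_mass]). So there are points
    p_k going to infinity with f (p_k) <= |p_k| / (k + 1), and by compactness
    and convexity a cluster point (v, tau) of p_k / |p_k| is a recession direction
    ([convex_on_recession]). If tau were 0, the integrable function
    exp (- f (., 1)) would be nondecreasing along the nonzero vector v, which is
    impossible ([no_recession_of_integrable]). Hence tau > 0 and c = v / tau. *)

(** * Borel sets and Lebesgue measure on row vectors *)

Lemma ball_rowE (R : realType) (n : nat) (x y : 'rV[R]_n) (e : R) :
  0 < e -> ball x e y <-> forall i, `|x ord0 i - y ord0 i| < e.
Proof.
move=> e0; split; first by move=> [_ b] i; exact: b.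
by move=> h; split => // i j; rewrite (ord1 i); exact: h.
Qed.

Lemma measurable_ball_row (R : realType) (n : nat) (c : 'rV[R]_n) (r : R) :
  0 < r -> measurable (ball c r : set 'rV[R]_n).
Proof.
move=> r0.
rewrite (_ : ball c r =
    \bigcap_(i in [set: 'I_n]) ((fun x => x ord0 i) @^-1` ball (c ord0 i) r)).
  apply: fin_bigcap_measurable => // i _; rewrite -[X in measurable X]setTI.
  apply: measurable_row_coord => //.
  by apply: open_measurable; exact: ball_open.
by apply/seteqP; split => x /=; [move=> /(ball_rowE _ _ r0) h i _; exact: h|
  move=> h; apply/(ball_rowE _ _ r0) => i; exact: h].
Qed.

(** The sigma-algebra generated by the coordinates contains the cubes, and an
    open set is the union of the countably many cubes with rational centre and
    radius 1/(k+1) that it contains. *)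
Lemma open_row_measurable (R : realType) (n : nat) (U : set 'rV[R]_n) :
  open U -> measurable U.
Proof.
move=> oU.
pose box (p : 'rV[rat]_n * nat) : set 'rV[R]_n :=
  ball (map_mx (@ratr R) p.1 : 'rV[R]_n) p.2.+1%:R^-1.
have -> : U = \bigcup_p (if `[< box p `<=` U >] then box p else set0).
  apply/seteqP; split => [x Ux|x [p _]]; last by case: asboolP => // /[apply].
  have /nbhs_ballP[e /= e0 eU] : nbhs x U by exact: open_nbhs_nbhs.
  have [k _ ke] : exists2 k : nat, True & k.+1%:R^-1 < e / 2.
    have := near_infty_natSinv_lt (PosNum (divr_gt0 e0 (ltr0n R 2))).
    by move=> [k _ /(_ k (leqnn k))] /= ?; exists k.
  have k0 : 0 < (k.+1%:R^-1 : R) by rewrite invr_gt0.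
  have qP i : exists q : rat, `|ratr q - x ord0 i| < (k.+1%:R^-1 : R).
    have /rat_in_itvoo[q] : x ord0 i - k.+1%:R^-1 < x ord0 i + k.+1%:R^-1.
      by rewrite ltrBlDr -addrA ltrDl addr_gt0.
    rewrite in_itv/= => /andP[q1 q2]; exists q.
    by rewrite ltr_distl q1 q2.
  have [q qx] := boolp.choice qP.
  have xb : box (\row_i q i, k) x.
    by apply/ball_rowE => // i; rewrite !mxE.
  exists (\row_i q i, k) => //; case: asboolP => // nU; exfalso; apply: nU.
  move=> y yb; apply: eU; apply: (@le_ball _ _ _ (k.+1%:R^-1 + k.+1%:R^-1)).
    by rewrite [leRHS]splitr; apply: lerD; exact: ltW.
  by apply: ball_triangle yb; exact: ball_sym.
apply: countable_bigcupT_measurable => [|p]; first exact: countableP.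
by case: ifP => // _; exact: measurable_ball_row.
Qed.

Lemma continuous_row_measurable (R : realType) (n : nat) (f : 'rV[R]_n -> R) :
  continuous f -> measurable_fun [set: 'rV[R]_n] f.
Proof.
move=> /continuousP cf; apply: (measurability _ (RGenOpens.measurableE R)).
move=> _ [_ [a [b ->] <-]]; rewrite setTI; apply: open_row_measurable.
exact/cf/interval_open.
Qed.

(** Tonelli's theorem in the form that matches the recursive construction of
    the measure, for computing integrals by induction on the dimension. *)
Lemma integral_lebesgue_rowS (R : realType) (n : nat)
    (f : 'rV[R]_n.+1 -> \bar R) :
  measurable_fun [set: 'rV[R]_n.+1] f -> (forall x, 0 <= f x)%E ->
  (\int[lebesgue_row n.+1]_x f x =
   \int[lebesgue_measure]_a \int[lebesgue_row n]_x f (row_cons (a, x)))%E.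
Proof.
move=> mf f0.
transitivity (\int[(lebesgue_measure \x lebesgue_row n)%E]_p
    (f \o @row_cons R n) p)%E.
  rewrite -(@ge0_integral_pushforward _ _ _ _ _ _
    (@measurable_row_cons R n) _ setT) //.
rewrite fubini_tonelli1 //; last by move=> p; exact: f0.
by apply: measurableT_comp => //; exact: measurable_row_cons.
Qed.

Lemma ge0_integral_lebesgue_shift (R : realType) (c : R) (f : R -> \bar R) :
  measurable_fun [set: R] f -> (forall r, 0 <= f r)%E ->
  (\int[lebesgue_measure]_r f (r + c)%R = \int[lebesgue_measure]_r f r)%E.
Proof.
move=> mf f0.
have mc : measurable_fun [set: measurableTypeR R]
    ((fun r => r + c) : measurableTypeR R -> measurableTypeR R).
  exact: measurable_funD.
have := @ge0_integral_pushforward _ _ _ _ _ _ mc lebesgue_measure setT f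
  measurableT mf.
rewrite preimage_setT /comp => <- //.
apply: eq_measure_integral => A mA _.
suff : pushforward lebesgue_measure
    ((fun r => r + c) : measurableTypeR R -> measurableTypeR R) A =
    lebesgue_measure A by [].
apply/esym/lebesgue_measure_unique => //= {A mA}.
move=> _ [[a b]] _ <-; rewrite /pushforward/=.
rewrite (_ : _ @^-1` _ = `]a - c, b - c]%classic); last first.
  by apply/seteqP; split => r /=; rewrite !in_itv/= ltrBlDr lerBrDr.
by rewrite !lebesgue_measure_itv/= !lte_fin ltrD2r -!EFinB opprB addrA subrK.
Qed.

Lemma row_consD (R : realType) (n : nat) (a : R) (x : 'rV[R]_n)
    (v : 'rV[R]_n.+1) :
  row_cons (a, x) + v =
  row_cons (a + v ord0 ord0, x + (row_uncons v).2).
Proof.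
apply/rowP => i; rewrite !mxE; case: (unliftP ord0 i) => [j|] -> //=.
by rewrite !mxE.
Qed.

Lemma ge0_integral_lebesgue_row_shift (R : realType) (n : nat) (v : 'rV[R]_n)
    (f : 'rV[R]_n -> \bar R) :
  measurable_fun [set: 'rV[R]_n] f -> (forall x, 0 <= f x)%E ->
  (\int[lebesgue_row n]_x f (x + v)%R = \int[lebesgue_row n]_x f x)%E.
Proof.
elim: n v f => [v f _ _|n IH v f mf f0].
  by apply: eq_integral => x _; rewrite (_ : (x + v)%R = x) //;
    apply/rowP => -[].
have mshift : measurable_fun [set: 'rV[R]_n.+1] (fun x : 'rV[R]_n.+1 => x + v).
  apply/measurable_fun_rowP => i.
  under eq_fun do rewrite mxE.
  by apply: measurable_funD => //; exact: measurable_row_coord.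
have mfS : measurable_fun [set: 'rV[R]_n.+1] (fun x => f (x + v)).
  exact: measurableT_comp.
rewrite !integral_lebesgue_rowS //.
have mfc : measurable_fun setT (f \o @row_cons R n).
  by apply: measurableT_comp => //; exact: measurable_row_cons.
transitivity (\int[lebesgue_measure]_a \int[lebesgue_row n]_x
   f (row_cons ((a + v ord0 ord0)%R, x)))%E.
  apply: eq_integral => a _.
  rewrite -[RHS](IH (row_uncons v).2) //; last first.
    exact: (measurableT_comp mfc (measurable_pair1 _)).
  by apply: eq_integral => x _; rewrite row_consD.
apply: (@ge0_integral_lebesgue_shift R (v ord0 ord0)
  (fun a => \int[lebesgue_row n]_x f (row_cons (a, x)))%E); last first.
  by move=> r; apply: integral_ge0 => x _; exact: f0.
apply: (@measurable_fun_fubini_tonelli_F _ _ _ _ R (lebesgue_row n)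
  (f \o @row_cons R n)).
- exact: mfc.
- by move=> p; exact: f0.
Qed.

Lemma integral_expR_norm_lty (R : realType) (d : R) : 0 < d ->
  (\int[lebesgue_measure]_a (expR (- (d * `|a|)))%:E < +oo)%E.
Proof.
move=> d0.
have cf : continuous (fun a : R => expR (- (d * `|a|))).
  move=> a; apply: continuous_comp; last exact: continuous_expR.
  apply: (@continuousN _ R^o); apply: continuousM; first exact: cst_continuous.
  exact: (@norm_continuous _ R^o).
rewrite ge0_symfun_integralT //; last by move=> a /=; rewrite normrN.
rewrite lte_mul_pinfty ?lee_fin //.
rewrite -set_itvcy integral_mkcond.
rewrite [X in (X < _)%E](_ : _ =
    (\int[lebesgue_measure]_a ((d^-1)%:E * (exponential_pdf d a)%:E))%E).
  rewrite ge0_integralZl //.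
  - by rewrite integral_exponential_pdf // mule1 ltry.
  - by apply/measurable_EFinP; exact: measurable_exponential_pdf.
  - by move=> a _; rewrite lee_fin exponential_pdf_ge0 // ltW.
  - by rewrite lee_fin invr_ge0 ltW.
apply: eq_integral => a _; rewrite /exponential_pdf !patchE.
case: ifPn => [|_]; last by rewrite mule0.
rewrite inE/= in_itv/= andbT => a0; rewrite ger0_norm // -EFinM mulrA.
by rewrite mulVf ?gt_eqF // mul1r mulNr.
Qed.

Lemma measurable_row_expR_norm (R : realType) (n : nat) (d : R) :
  measurable_fun [set: 'rV[R]_n]
    (fun x => (expR (- (d * \sum_(i < n) `|x ord0 i|)))%:E).
Proof.
apply/measurable_EFinP; apply: measurableT_comp => //.
apply: measurableT_comp => //; apply: measurable_funM => //.
apply: measurable_sum => i; apply: measurableT_comp => //.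
exact: measurable_row_coord.
Qed.

(** The 1-norm in the exponent makes the integrand a product of functions of
    one coordinate, so that the induction on the dimension is immediate. *)
Lemma integral_row_expR_norm_lty (R : realType) (n : nat) (d : R) : 0 < d ->
  (\int[lebesgue_row n]_x (expR (- (d * \sum_(i < n) `|x ord0 i|)))%:E < +oo)%E.
Proof.
move=> d0.
have mf k := @measurable_row_expR_norm R k d.
elim: n => [|n IH].
  rewrite integral_dirac //; last exact: mf.
  by rewrite /= /dirac indicE in_setT mul1e ltry.
rewrite integral_lebesgue_rowS //.
have mf1 : measurable_fun [set: R] (fun a : R => (expR (- (d * `|a|)))%:E).
  apply/measurable_EFinP; apply: measurableT_comp => //.
  by apply: measurableT_comp => //; exact: measurable_funM.
have K0 : (0 <= \int[lebesgue_row n]_x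
    (expR (- (d * \sum_(i < n) `|x ord0 i|)))%:E)%E.
  by apply: integral_ge0 => x _; rewrite lee_fin expR_ge0.
rewrite (eq_integral (fun a : measurableTypeR R => (expR (- (d * `|a|)))%:E *
    \int[lebesgue_row n]_x (expR (- (d * \sum_(i < n) `|x ord0 i|)))%:E)%E).
  have I0 :
      (0 <= \int[@lebesgue_measure R]_a (expR (- (d * `|a|)))%:E)%E.
    by apply: integral_ge0 => a _; rewrite lee_fin expR_ge0.
  rewrite ge0_integralZr //.
  rewrite lte_mul_pinfty // ge0_fin_numE //.
  exact: integral_expR_norm_lty.
move=> a _; rewrite -ge0_integralZl ?lee_fin ?expR_ge0 //; last exact: mf.
apply: eq_integral => x _; rewrite -EFinM -expRD -opprD -mulrDr.
rewrite big_ord_recl mxE unlift_none/=; do 5 f_equal.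
by apply: eq_bigr => i _; rewrite mxE liftK.
Qed.

Lemma lebesgue_row_ball_gt0 (R : realType) (n : nat) (c : 'rV[R]_n) (r : R) :
  0 < r -> (0 < lebesgue_row n (ball c r))%E.
Proof.
move=> r0; elim: n c => [c|n IH c].
  by rewrite /= /dirac indicE mem_set ?lte01 //; apply/ball_rowE => // -[].
rewrite /= /lebesgue_row_step /pushforward.
rewrite (_ : _ @^-1` _ = ball (c ord0 ord0) r `*` ball (row_uncons c).2 r).
  rewrite product_measure1E; last 2 first.
  - by apply: open_measurable; exact: ball_open.
  - exact: measurable_ball_row.
  apply: mule_gt0; last exact: IH.
  suff : (0 < lebesgue_measure (ball (c ord0 ord0) r))%E by [].
  by rewrite lebesgue_measure_ball ?ltW // lte_fin mulrn_wgt0.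
apply/seteqP; split => -[a x] /=.
  move=> /(ball_rowE _ _ r0) h; split.
    by have := h ord0; rewrite mxE unlift_none.
  by apply/ball_rowE => // i; have := h (lift ord0 i); rewrite !mxE liftK.
move=> [ha /(ball_rowE _ _ r0) hx]; apply/ball_rowE => // i.
rewrite !mxE; case: unliftP => [j ->|->] //=.
by have := hx j; rewrite mxE.
Qed.

(** If g exceeded f at a point, it would exceed f by a fixed e > 0 on a ball,
    and the integral of g would exceed that of f by e times the measure of the
    ball. In both uses below g is a translate, whose integral is known by
    translation invariance. *)
Lemma eq_continuous_of_integral (R : realType) (n : nat) (f g : 'rV[R]_n -> R) :
  continuous f -> continuous g -> (forall x, 0 <= f x <= g x) ->
  (\int[lebesgue_row n]_x (f x)%:E < +oo)%E ->
  (\int[lebesgue_row n]_x (g x)%:E <= \int[lebesgue_row n]_x (f x)%:E)%E ->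
  f = g.
Proof.
move=> cf cg fg foo gf; apply/funext => x0; apply/eqP; rewrite eq_le.
have f0 x : 0 <= f x by have /andP[] := fg x.
rewrite (andP (fg x0)).2 /= leNgt; apply/negP => fgx0.
pose e := (g x0 - f x0) / 2.
have e0 : 0 < e by rewrite divr_gt0 // subr_gt0.
have mf : measurable_fun [set: 'rV[R]_n] (EFin \o f).
  by apply/measurable_EFinP; exact: continuous_row_measurable.
have mg : measurable_fun [set: 'rV[R]_n] (EFin \o g).
  by apply/measurable_EFinP; exact: continuous_row_measurable.
have [r /= r0 rB] : exists2 r : R, 0 < r &
    forall x, ball x0 r x -> f x + e <= g x.
  have : \forall x \near x0, f x + e < g x.
    have c : {for x0, continuous (fun x => g x - f x)}.
      by apply: (@continuousB _ R^o); [exact: cg|exact: cf].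
    have : e < g x0 - f x0 by rewrite ltr_pdivrMr // ltr_pMr ?subr_gt0 // ltr1n.
    move=> /(cvgr_gt _ c); apply: filterS => x; lra.
  by move=> /nbhs_ballP[r r0 rB]; exists r => // x /rB/ltW.
have mB : measurable (ball x0 r : set 'rV[R]_n) by exact: measurable_ball_row.
have mI : measurable_fun [set: 'rV[R]_n] (fun x => (e * \1_(ball x0 r) x)%:E).
  by apply/measurable_EFinP; apply: measurable_funM.
suff : (\int[lebesgue_row n]_x (f x)%:E + e%:E * lebesgue_row n (ball x0 r) <=
        \int[lebesgue_row n]_x (f x)%:E)%E.
  have Ifin : (\int[lebesgue_row n]_x (f x)%:E)%E \is a fin_num.
    by rewrite ge0_fin_numE //; apply: integral_ge0 => x _; rewrite lee_fin.
  by rewrite leNgt lteDl // mule_gt0 // lebesgue_row_ball_gt0.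
apply: le_trans gf; rewrite -[X in (_ * lebesgue_row _ X)%E]setIT.
rewrite -integral_indic // -ge0_integralZl //; last 2 first.
  by apply/measurable_EFinP.
  by rewrite lee_fin ltW.
rewrite -ge0_integralD //; last 2 first.
  by move=> x _; rewrite lee_fin.
  by move=> x _; rewrite lee_fin mulr_ge0 // ltW.
apply: ge0_le_integral => //.
- by move=> x _; rewrite adde_ge0 // lee_fin // mulr_ge0 // ltW.
- by apply: emeasurable_funD.
- move=> x _; rewrite -EFinM -EFinD lee_fin indicE.
  have [/set_mem/rB|_] := boolP (x \in _); rewrite ?mulr1 // mulr0 addr0.
  by have /andP[] := fg x.
Qed.

(** * Continuity of finite convex functions *)

(** The notion of [convex_function], with a coefficient of type R and
    propositional membership, so that instances are plain applications. *)
Definition convex_on (R : realType) (E : lmodType R) (D : set E) (f : E -> R) :=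
  forall (x y : E) (a : R), D x -> D y -> 0 <= a <= 1 ->
    f (a *: x + (1 - a) *: y) <= a * f x + (1 - a) * f y.

Lemma convex_functionW (R : realType) (E : lmodType R) (D : set E)
    (f : E -> R^o) : convex_function D f -> convex_on D f.
Proof.
move=> cf x y a Dx Dy a01.
have ha : Itv.spec (@Itv.num_sem R) (Itv.Real `[0%Z, 1%Z]) a.
  by rewrite /= /Itv.num_sem /= num_real in_itv /=.
exact: (cf (Itv.mk ha) x y (mem_set Dx) (mem_set Dy)).
Qed.

(** For y at distance less than th * r from z, the point y lies between z and
    w = z + (y - z) / th, and z lies between y and w' = z + (z - y) / th,
    where w and w' are still in the ball. Convexity along these two segments
    gives |f y - f z| <= th * (M - f z). *)
Lemma convex_on_near_continuous (R : realType) (E : normedModType R)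
    (f : E -> R) (z : E) (r M : R) : 0 < r ->
  convex_on (ball z r) f -> (forall y, ball z r y -> f y <= M) ->
  {for z, continuous f}.
Proof.
move=> r0 cf fM.
have bz : ball z r z by exact: ballxx.
have C0 : 0 < M - f z + 1 by have := fM _ bz; lra.
apply/(@cvgrPdist_lt _ R^o) => e e0.
pose th := Num.min 1 (e / (M - f z + 1)).
have th0 : 0 < th by rewrite lt_min ltr01 divr_gt0.
have th1 : th <= 1 by rewrite ge_min lexx.
have the : th * (M - f z + 1) <= e.
  by rewrite -ler_pdivlMr // ge_min lexx orbT.
apply/nbhs_ballP; exists (th * r) => /=; first exact: mulr_gt0.
move=> y; rewrite -ball_normE /= => yz.
have thN : th^-1 * `|z - y| < r by rewrite mulrC ltr_pdivrMr // mulrC.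
have b1 : ball z r (z + th^-1 *: (y - z)).
  rewrite -ball_normE /= opprD addrA subrr add0r normrN normrZ.
  by rewrite gtr0_norm ?invr_gt0 // distrC.
have b2 : ball z r (z + th^-1 *: (z - y)).
  rewrite -ball_normE /= opprD addrA subrr add0r normrN normrZ.
  by rewrite gtr0_norm ?invr_gt0.
have th01 : 0 <= th <= 1 by rewrite (ltW th0).
have := cf _ _ _ b1 bz th01.
have -> : th *: (z + th^-1 *: (y - z)) + (1 - th) *: z = y.
  rewrite scalerDr scalerA mulfV ?gt_eqF // scale1r scalerBl scale1r.
  by rewrite addrC addrA addrNK subrKC.
have by_ : ball z r y.
  rewrite -ball_normE /=; apply: (lt_le_trans yz).
  by rewrite ger_pMl.
have al0 : 0 < (1 + th)^-1 by rewrite invr_gt0 addr_gt0.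
have al1 : (1 + th) * (1 + th)^-1 = 1 by rewrite mulfV // gt_eqF // addr_gt0.
have al01 : 0 <= (1 + th)^-1 <= 1.
  by rewrite (ltW al0) /= invf_le1 ?addr_gt0 // lerDl ltW.
have := cf _ _ _ by_ b2 al01.
have -> : (1 + th)^-1 *: y + (1 - (1 + th)^-1) *: (z + th^-1 *: (z - y)) = z.
  have -> : 1 - (1 + th)^-1 = (1 + th)^-1 * th.
    by apply/eqP; rewrite subr_eq -{1}al1 mulrC mulrDr mulr1 addrC.
  rewrite -scalerA -scalerDr [th *: _]scalerDr (scalerA th) mulfV ?gt_eqF //.
  rewrite scale1r addrCA [y + _]addrC subrK addrC -{1}[z]scale1r.
  by rewrite -scalerDl scalerA mulrC al1 scale1r.
have m1 := fM _ b1; have m2 := fM _ b2.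
move: (f (z + th^-1 *: (y - z))) (f (z + th^-1 *: (z - y))) m1 m2 => u w m1 m2.
move=> h2 h1.
rewrite ltr_distl; apply/andP; split.
  have : (1 + th) * f z <= f y + th * w.
    have := ler_wpM2l (ltW (addr_gt0 ltr01 th0)) h2.
    have -> : 1 - (1 + th)^-1 = (1 + th)^-1 * th.
      by apply/eqP; rewrite subr_eq -{1}al1 mulrC mulrDr mulr1 addrC.
    by rewrite -mulrA -mulrDr mulrA al1 mul1r.
  nra.
nra.
Qed.

(** Halving the distance to z splits off one direction at a time:
    z + a i *: e i + S is the midpoint of z + (2 * a i) *: e i and z + 2 *: S.
    This doubles the range of the remaining coefficients, which is why rho is
    universally quantified in the induction. On the segment in the direction e
    i, f is bounded by its values at the two ends. *)
Lemma convex_on_sum_bounded (R : realType) (E : lmodType R) (I : Type)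
    (f : E -> R) (e : I -> E) (z : E) (s : seq I) :
  convex_on setT f -> forall rho : R, 0 <= rho -> exists M : R,
  forall a : I -> R, (forall i, `|a i| <= rho) ->
    f (z + \sum_(i <- s) a i *: e i) <= M.
Proof.
move=> cf; elim: s => [|i s IH] rho rho0.
  by exists (f z) => a _; rewrite big_nil addr0.
have [|M hM] := IH (2 * rho); first exact: mulr_ge0.
pose u := z + (2 * rho) *: e i; pose v := z + (- (2 * rho)) *: e i.
exists (2^-1 * (`|f u| + `|f v|) + 2^-1 * M) => a ha.
have -> : z + \sum_(j <- i :: s) a j *: e j =
    2^-1 *: (z + (2 * a i) *: e i) +
    (1 - 2^-1) *: (z + \sum_(j <- s) (2 * a j) *: e j).
  have -> : 1 - 2^-1 = 2^-1 :> R by lra.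
  rewrite big_cons -scalerDr addrACA scalerDr -mulr2n -[z *+ 2]scaler_nat.
  rewrite scalerA mulVf // scale1r scalerDr scalerA mulrA mulVf // mul1r.
  congr (_ + (_ + _)); rewrite scaler_sumr; apply: eq_bigr => j _.
  by rewrite scalerA mulrA mulVf // mul1r.
apply: le_trans (cf _ _ _ _ _ _) _ => //; first by apply/andP; split; lra.
have -> : 1 - 2^-1 = 2^-1 :> R by lra.
apply: lerD; apply: ler_wpM2l; rewrite ?invr_ge0 //; last first.
  by apply: hM => j; rewrite normrM ger0_norm // ler_wpM2l.
have [rho_eq0|rho_neq0] := eqVneq rho 0.
  have -> : a i = 0 by apply/eqP; rewrite -normr_le0 -rho_eq0.
  rewrite /u /v rho_eq0 mulr0 oppr0 scale0r addr0.
  by rewrite (le_trans (ler_norm _)) // lerDl.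
have rhop : 0 < rho by rewrite lt_neqAle eq_sym rho_neq0.
(* b is the position of z + (2 * a i) *: e i on the segment from v to u. *)
pose b := (1 + a i / rho) / 2.
have /andP[b1 b2] : -1 <= a i / rho <= 1.
  by rewrite -ler_norml normrM normfV (gtr0_norm rhop) ler_pdivrMr // mul1r.
have b01 : 0 <= b <= 1 by rewrite /b; apply/andP; split; lra.
have := cf u v b Logic.I Logic.I b01.
have -> : b *: u + (1 - b) *: v = z + (2 * a i) *: e i.
  rewrite /u /v !scalerDr !scalerA addrACA -!scalerDl subrKC scale1r.
  congr (_ + _ *: _); by rewrite /b; field.
have /andP[b0 b1'] := b01.
have := ler_norm (f u); have := ler_norm (f v).
have := normr_ge0 (f u); have := normr_ge0 (f v).
nra.
Qed.

Lemma convex_on_row_bounded (R : realType) (n : nat) (f : 'rV[R]_n -> R)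
    (z : 'rV[R]_n) (r : R) : 0 < r ->
  convex_on setT f -> exists M : R, forall y, ball z r y -> f y <= M.
Proof.
move=> r0 cf.
have [M hM] := @convex_on_sum_bounded R 'rV[R]_n 'I_n f (delta_mx 0) z
  (index_enum 'I_n) cf r (ltW r0).
exists M => y /(ball_rowE _ _ r0) zy.
have -> : y = z + \sum_(i <- index_enum 'I_n) (y - z) 0 i *: delta_mx 0 i.
  by rewrite -[X in _ + X]row_sum_delta subrKC.
by apply: hM => i; rewrite !mxE distrC ltW.
Qed.

Lemma convex_on_row_continuous (R : realType) (n : nat) (f : 'rV[R]_n -> R) :
  convex_on setT f -> continuous f.
Proof.
move=> cf z; have [M hM] := convex_on_row_bounded z ltr01 cf.
by apply: convex_on_near_continuous hM => // x y a _ _; exact: cf.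
Qed.

(** * Convex functions on a half-space and their recession directions *)

Local Notation upper_half R n :=
  ([set: 'rV[R]_n] `*` [set t : R | 0 <= t] : set ('rV[R]_n * R^o)%type).

Lemma convex_on_upper_half_slice (R : realType) (n : nat)
    (f : 'rV[R]_n * R^o -> R) (t : R) :
  convex_on (upper_half R n) f -> 0 <= t ->
  convex_on setT (fun x => f (x, t)).
Proof.
move=> cf t0 x y a _ _ a01.
have := cf (x, t) (y, t) a (conj Logic.I t0) (conj Logic.I t0) a01.
by congr (f (_, _) <= _); rewrite /= -mulrDl addrC subrK mul1r.
Qed.

(** A bound near (x0, t0) is enough. The point (x, t) is the midpoint of
    (2 x - x0, t0), where f is bounded by convexity of the slice t0, and
    (x0, 2 t - t0), which lies on the vertical segment between (x0, 0) and
    (x0, 2 t0). *)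
Lemma convex_on_upper_half_continuous (R : realType) (n : nat)
    (f : 'rV[R]_n * R^o -> R) (z : 'rV[R]_n * R^o) :
  convex_on (upper_half R n) f -> 0 < z.2 -> {for z, continuous f}.
Proof.
case: z => x0 t0 /= cf t00.
have cx := convex_on_upper_half_slice cf (ltW t00).
have [M1 hM1] := convex_on_row_bounded x0 t00 cx.
pose M2 := `|f (x0, 0)| + `|f (x0, 2 * t0)|.
have t02 : 0 < t0 / 2 by rewrite divr_gt0.
apply: (@convex_on_near_continuous _ _ _ _ (t0 / 2)
  (2^-1 * M1 + 2^-1 * M2)) => //.
  have sub (q : 'rV[R]_n * R^o) : ball (x0, t0) (t0 / 2) q -> upper_half R n q.
    move=> [_ /=]; rewrite -ball_normE /= ltr_distlC => /andP[h _].
    by split => //=; lra.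
  by move=> p q a /sub hp /sub hq; exact: cf.
move=> [x t] [/= bx]; rewrite -ball_normE /= ltr_distlC => /andP[t1 t2].
have -> : (x, t) = 2^-1 *: (2 *: x - x0, t0) + (1 - 2^-1) *: (x0, 2 * t - t0)
    :> 'rV[R]_n * R^o.
  have -> : 1 - 2^-1 = 2^-1 :> R by lra.
  congr (_, _); last by rewrite /= -mulrDr addrC subrK mulrA mulVf // mul1r.
  by rewrite /= -scalerDr subrK scalerA mulVf // scale1r.
have t1' : 0 <= 2 * t - t0 by lra.
apply: le_trans (cf _ _ _ _ _ _) _ => //=.
- by split => //=; exact: ltW.
- by apply/andP; split; lra.
have -> : 1 - 2^-1 = 2^-1 :> R by lra.
apply: lerD; apply: ler_wpM2l; rewrite ?invr_ge0 //.
  apply: hM1; apply/ball_rowE => // i; move/(ball_rowE _ _ t02) : bx => /(_ i).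
  rewrite !mxE !ltr_distlC => /andP[h1 h2]; apply/andP; split; lra.
pose b := (2 * t - t0) / (2 * t0).
have b01 : 0 <= b <= 1.
  apply/andP; split; first by apply: divr_ge0 => //; lra.
  by rewrite ler_pdivrMr; lra.
have := cf (x0, 2 * t0) (x0, 0) b
  (conj Logic.I (ltW (mulr_gt0 (ltr0n R 2) t00)))
  (conj Logic.I (lexx 0)) b01.
have -> : b *: (x0, 2 * t0) + (1 - b) *: (x0, 0) = (x0, 2 * t - t0)
    :> 'rV[R]_n * R^o.
  congr (_, _); first by rewrite /= -scalerDl addrC subrK scale1r.
  rewrite /= [X in _ + X]mulr0 addr0; apply: mulfVK.
  by rewrite gt_eqF // mulr_gt0.
move=> /le_trans; apply; rewrite /M2.
have /andP[b0 b1] := b01.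
have := ler_norm (f (x0, 0)); have := ler_norm (f (x0, 2 * t0)).
have := normr_ge0 (f (x0, 0)); have := normr_ge0 (f (x0, 2 * t0)).
nra.
Qed.

Lemma compact_unit_ball_row_pair (R : realType) (n : nat) :
  compact ([set p : 'rV[R]_n * R^o | `|p| <= 1]).
Proof.
have -> : [set p : 'rV[R]_n * R^o | `|p| <= 1] =
    [set x | `|x| <= 1] `*` [set t : R^o | `|t| <= 1].
  apply/seteqP; split => -[x t] /=; rewrite prod_normE ge_max.
    by move=> /andP[].
  by move=> [-> ->].
apply: compact_setX.
  apply: bounded_closed_compact.
    by exists 1; split => // M M1 x /= x1; exact: le_trans (ltW M1).
  have := @closed_closed_ball_ R 'rV[R]_n 0 1; congr closed.
  by apply/seteqP; split => x; rewrite /closed_ball_/= sub0r normrN.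
have -> : [set t : R^o | `|t| <= 1] = `[-1, 1]%classic.
  by apply/seteqP; split => t /=; rewrite in_itv/= ler_norml.
exact: segment_compact.
Qed.

(** Points p_k that go to infinity while f (p_k) <= o(|p_k|) produce a
    recession direction q, a cluster point of p_k / |p_k|. Indeed z + s q is a
    limit of the points (1 - s / |p_k|) z + (s / |p_k|) p_k, at which
    convexity bounds f by f z + o(1). The limit is taken by continuity at z +
    s q, whence the hypothesis that this point lies in the open half-space: at
    the boundary f may jump. *)
Lemma convex_on_recession (R : realType) (n : nat)
    (f : 'rV[R]_n * R^o -> R) (p_ : nat -> 'rV[R]_n * R^o) :
  convex_on (upper_half R n) f -> (forall k, 0 <= (p_ k).2) ->
  (forall k, k.+1%:R <= `|p_ k|) ->
  (forall k, f (p_ k) <= `|p_ k| / k.+1%:R) ->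
  exists q : 'rV[R]_n * R^o, [/\ q != 0, 0 <= q.2 &
    forall (z : 'rV[R]_n * R^o) (s : R), 0 <= z.2 -> 0 <= s ->
      0 < z.2 + s * q.2 -> f (z + s *: q) <= f z].
Proof.
move=> cf p2 pk fp.
have l0 k : 0 < `|p_ k| by apply: lt_le_trans (pk k).
pose q_ k : 'rV[R]_n * R^o := `|p_ k|^-1 *: p_ k.
have q1 k : `|q_ k| = 1.
  by rewrite normrZ ger0_norm ?invr_ge0 // mulVf // gt_eqF.
have q2 k : 0 <= (q_ k).2 by apply: mulr_ge0.
have [q [_ qc]] : exists q, ([set p : 'rV[R]_n * R^o | `|p| <= 1] `&`
    cluster (q_ @ \oo)) q.
  apply: (@compact_unit_ball_row_pair R n).
  by exists 0%N => // k _ /=; rewrite q1.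
have near_q (N : nat) (e : R) : 0 < e ->
    exists2 k, (N <= k)%N & `|q - q_ k| < e.
  move=> e0.
  have [||_ [[k Nk <-]]] := qc (q_ @` [set k | (N <= k)%N]) (ball q e).
  - by exists N => // k /= Nk; exists k.
  - exact: nbhsx_ballx.
  by rewrite -ball_normE /= => h; exists k.
have norm2 (p : 'rV[R]_n * R^o) : `|p.2| <= `|p|.
  by rewrite prod_normE le_max lexx orbT.
exists q; split.
- apply/eqP => q0; have [k _] := near_q 0%N 1 ltr01.
  by rewrite q0 sub0r normrN q1 ltxx.
- rewrite leNgt; apply/negP => q20.
  have [|k _] := near_q 0%N (- q.2); first by rewrite oppr_gt0.
  move=> /(le_lt_trans (norm2 _)) /=; rewrite ltr_norml => /andP[h _].
  have := q2 k; lra.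
move=> z s z0 s0 zs; rewrite leNgt; apply/negP => fz.
have [e e0 fzE] : exists2 e : R, 0 < e & f (z + s *: q) = f z + e + e + e.
  exists ((f (z + s *: q) - f z) / 3); last by field.
  by rewrite divr_gt0 // subr_gt0.
have [r /= r0 hr] : exists2 r : R, 0 < r &
    forall y, ball (z + s *: q) r y -> f (z + s *: q) < f y + e.
  have c := @convex_on_upper_half_continuous R n f (z + s *: q) cf zs.
  have /nbhs_ballP[r r0 hr] :
      nbhs (z + s *: q) (fun y => `|f (z + s *: q) - f y| < e).
    have /(@cvgrPdist_lt _ R^o) h := c; exact: h e0.
  exists r => // y /hr /=; rewrite ltr_distlC => /andP[h _]; lra.
have sz0 : 0 <= 2 * s * `|z| / r
  by apply: divr_ge0; [do 2 apply: mulr_ge0 => //|exact: ltW].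
have sf0 : 0 <= s * `|f z| / e
  by apply: divr_ge0; [apply: mulr_ge0|exact: ltW].
have se0 : 0 <= s / e
  by apply: divr_ge0; [|exact: ltW].
(* Each summand of B is the lower bound on k + 1, hence on |p_k|, that one of
   the estimates a1, az, af, sk below requires. *)
pose B := s + 2 * s * `|z| / r + s * `|f z| / e + s / e.
have [N BN] : exists N : nat, B < N%:R.
  by exists (Num.truncn B).+1; exact: truncnS_gt.
have s1 : 0 < s + 1 by lra.
have [k Nk qk] := near_q N (r / (2 * (s + 1)))
  (divr_gt0 r0 (mulr_gt0 (ltr0n R 2) s1)).
have BL : B < `|p_ k|.
  apply: lt_le_trans (pk k); apply: (lt_le_trans BN).
  by rewrite ler_nat ltnW.
have Bk : B < k.+1%:R.
  by apply: (lt_le_trans BN); rewrite ler_nat ltnW.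
pose a := s / `|p_ k|.
have a0 : 0 <= a by rewrite divr_ge0.
have a1 : a <= 1 by rewrite ler_pdivrMr // mul1r; rewrite /B in BL; lra.
have az : a * `|z| <= r / 2.
  rewrite /a mulrAC ler_pdivrMr // [leRHS]mulrC -ler_pdivrMr ?divr_gt0 //.
  rewrite [X in X <= _](_ : _ = 2 * s * `|z| / r); last first.
    by field; rewrite gt_eqF.
  by rewrite /B in BL; lra.
have af : a * `|f z| < e.
  rewrite /a mulrAC ltr_pdivrMr // [ltRHS]mulrC -ltr_pdivrMr //.
  rewrite /B in BL; lra.
have sk : s / k.+1%:R <= e.
  by rewrite ler_pdivrMr // [leRHS]mulrC -ler_pdivrMr //; rewrite /B in Bk; lra.
have sq : s * `|q - q_ k| < r / 2.
  have h1 : s * `|q - q_ k| <= s * (r / (2 * (s + 1))).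
    by apply: ler_wpM2l => //; exact: ltW.
  apply: (le_lt_trans h1).
  have -> : s * (r / (2 * (s + 1))) = s / (s + 1) * (r / 2).
    by field; rewrite gt_eqF.
  by rewrite gtr_pMl ?divr_gt0 // ltr_pdivrMr // mul1r ltrDl.
have := cf (p_ k) z a (conj Logic.I (p2 k)) (conj Logic.I z0).
rewrite a0 a1 => /(_ isT).
have wE : a *: p_ k = s *: q_ k by rewrite scalerA.
have bw : ball (z + s *: q) r (a *: p_ k + (1 - a) *: z).
  rewrite -ball_normE /= wE scalerBl scale1r.
  have -> : z + s *: q - (s *: q_ k + (z - a *: z)) = s *: (q - q_ k) + a *: z.
    rewrite scalerBr; move: (s *: q) (s *: q_ k) (a *: z) => q' w az'.
    by rewrite [w + _]addrCA [z + q']addrC addrKA opprB addrA addrAC.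
  apply: (le_lt_trans (ler_normD _ _)); rewrite normrZ (ger0_norm s0).
  have -> : `|a *: z| = a * `|z| by rewrite normrZ ger0_norm.
  lra.
have := hr _ bw => h1 h2.
have afp : a * f (p_ k) <= s / k.+1%:R.
  apply: le_trans (ler_wpM2l a0 (fp k)) _.
  by rewrite /a mulrA divfK // gt_eqF.
have afz : - (a * f z) <= a * `|f z|.
  by rewrite -mulrN -normrN; apply: ler_wpM2l => //; exact: ler_norm.
have afe := le_trans afp sk.
rewrite mulrBl mul1r in h2.
lra.
Qed.

(** * Integrals of exp (- f) along slices *)

Lemma continuous_row_shift (R : realType) (n : nat) (f : 'rV[R]_n -> R)
    (v : 'rV[R]_n) : continuous f -> continuous (fun x : 'rV[R]_n => f (x + v)).
Proof.
move=> cf x.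
have cv : {for x, continuous (fun y : 'rV[R]_n => y + v)}.
  by apply: continuousD => //; exact: cst_continuous.
exact: (continuous_comp cv (cf _)).
Qed.

Lemma continuous_row_expRN (R : realType) (n : nat) (f : 'rV[R]_n -> R) :
  continuous f -> continuous (fun x => expR (- f x)).
Proof.
move=> cf x; apply: continuous_comp; last exact: continuous_expR.
by apply: (@continuousN _ R^o); exact: cf.
Qed.

(** Otherwise f p > |p| / (k + 1) whenever |p| >= k + 1, and in particular on
    each slice t >= k + 1, where this gives f (x, t) >= d t + d' |x|_1. The
    mass of such a slice is at most K exp (- d t), which is less than Z for
    large t. *)
Lemma slow_growth_of_mass (R : realType) (n : nat) (f : 'rV[R]_n * R^o -> R)
    (Z : R) : 0 < Z ->
  (forall t, 0 <= t -> continuous (fun x => f (x, t))) ->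
  (forall t, 0 <= t ->
     (\int[lebesgue_row n]_x (expR (- f (x, t)))%:E)%E = Z%:E) ->
  forall k : nat, exists p : 'rV[R]_n * R^o,
    [/\ 0 <= p.2, k.+1%:R <= `|p| & f p <= `|p| / k.+1%:R].
Proof.
move=> Z0 cf fZ k; apply: contrapT => nex.
have lbf (p : 'rV[R]_n * R^o) : 0 <= p.2 -> k.+1%:R <= `|p| ->
    `|p| / k.+1%:R < f p.
  move=> p2 pk; rewrite ltNge; apply/negP => fp; apply: nex; exists p.
  by split.
pose d : R := (2 * k.+1%:R)^-1.
have d0 : 0 < d by rewrite invr_gt0 mulr_gt0.
pose d' : R := d / n.+1%:R.
have d'0 : 0 < d' by rewrite divr_gt0.
pose K := (\int[lebesgue_row n]_x
  (expR (- (d' * \sum_(i < n) `|x ord0 i|)))%:E)%E.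
have Koo : (K < +oo)%E := integral_row_expR_norm_lty n d'0.
have K0 : (0 <= K)%E by apply: integral_ge0 => x _; rewrite lee_fin expR_ge0.
have Kfin : K = (fine K)%:E by rewrite fineK // ge0_fin_numE.
have k0 : 0 <= fine K by rewrite -lee_fin -Kfin.
(* Since exp (d t) >= 1 + d t, this t already makes K exp (- d t) < Z. *)
pose t : R := k.+1%:R + fine K / (Z * d).
have Zd : 0 < Z * d by rewrite mulr_gt0.
have tk : k.+1%:R <= t by rewrite lerDl divr_ge0 // ltW.
have t0 : 0 <= t by apply: le_trans tk.
have lower (x : 'rV[R]_n) : d * t + d' * \sum_(i < n) `|x ord0 i| <= f (x, t).
  have tp : t <= `|(x, t) : 'rV[R]_n * R^o|.
    by rewrite prod_normE le_max /= ger0_norm // lexx orbT.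
  have xp : `|x| <= `|(x, t) : 'rV[R]_n * R^o|.
    by rewrite prod_normE le_max lexx.
  apply: le_trans (ltW (lbf (x, t) t0 (le_trans tk tp))).
  have sx : \sum_(i < n) `|x ord0 i| <= n.+1%:R * `|x|.
    apply: (@le_trans _ _ (\sum_(i < n) `|x|)).
      apply: ler_sum => i _; rewrite [leRHS]mx_normrE.
      by apply/bigmax_geP; right; exists (ord0, i).
    rewrite sumr_const card_ord -[leLHS]mulr_natl; apply: ler_wpM2r => //.
    by rewrite ler_nat.
  have -> : `|(x, t) : 'rV[R]_n * R^o| / k.+1%:R =
      d * `|(x, t) : 'rV[R]_n * R^o| + d * `|(x, t) : 'rV[R]_n * R^o|.
    by rewrite /d; field.
  apply: lerD; first by rewrite ler_pM2l.
  rewrite /d' -mulrA ler_pM2l // mulrC ler_pdivrMr // mulrC.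
  by apply: (le_trans sx); rewrite ler_pM2l.
have mK := @measurable_row_expR_norm R n d'.
have : (Z%:E <= (expR (- (d * t)))%:E * K)%E.
  rewrite -(fZ t t0) /K -ge0_integralZl ?lee_fin ?expR_ge0 //.
  apply: ge0_le_integral => //.
  - apply/measurable_EFinP; apply: continuous_row_measurable.
    by apply: continuous_row_expRN; exact: cf.
  - exact: measurable_funeM.
  - move=> x _; rewrite -EFinM lee_fin -expRD ler_expR -opprD lerN2.
    exact: lower.
rewrite Kfin -EFinM lee_fin expRN mulrC ler_pdivlMr ?expR_gt0 // => h.
have h1 : Z * (1 + d * t) <= fine K.
  by apply: le_trans h; rewrite ler_pM2l // expR_ge1Dx.
have : fine K <= Z * d * t.
  by rewrite mulrC -ler_pdivrMr // lerDr.
nra.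
Qed.

(** The density exp (- g) does not decrease under translation by v.
    Multiplying it by a bounded function phi that is strictly increasing along
    v, a logistic function of a coordinate i with v i <> 0, gives an
    integrable G with G x <= G (x + v), strictly since exp (- g) > 0.
    Translation invariance and [eq_continuous_of_integral] force equality. *)
Lemma no_recession_of_integrable (R : realType) (n : nat) (g : 'rV[R]_n -> R)
    (v : 'rV[R]_n) : continuous g -> v != 0 ->
  (\int[lebesgue_row n]_x (expR (- g x))%:E < +oo)%E ->
  ~ (forall x, g (x + v) <= g x).
Proof.
move=> cg v0 goo gv.
have [i vi] : exists i, v ord0 i != 0.
  apply: contrapT => nv; move/eqP: v0; apply; apply/rowP => i; rewrite mxE.
  by apply/eqP; apply: contrapT => /negP vi; apply: nv; exists i.
pose phi (x : 'rV[R]_n) := (1 + expR (- (v ord0 i * x ord0 i)))^-1.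
have phi0 x : 0 < phi x by rewrite invr_gt0 addr_gt0 // expR_gt0.
have cphi : continuous phi.
  move=> x; have c1 : {for x, continuous
      (fun y : 'rV[R]_n => (1 + expR (- (v ord0 i * y ord0 i)) : R^o))}.
    apply: continuousD; first exact: cst_continuous.
    apply: continuous_comp; last exact: continuous_expR.
    apply: (@continuousN _ R^o); apply: continuousM.
      exact: cst_continuous.
    exact: coord_continuous.
  apply: (cvgV _ c1); first by rewrite gt_eqF // addr_gt0 // expR_gt0.
have phiD x : phi x < phi (x + v).
  rewrite ltf_pV2 ?posrE ?addr_gt0 ?expR_gt0 // ltrD2l ltr_expR ltrN2.
  by rewrite mxE mulrDr ltrDl -expr2 exprn_even_gt0.
pose G x := expR (- g x) * phi x.
have cG : continuous G.
  move=> x; apply: (@continuousM _ _ (fun y => expR (- g y)) phi x).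
    exact: continuous_row_expRN.
  exact: cphi.
have G0 x : 0 <= G x by rewrite mulr_ge0 ?expR_ge0 // ltW.
have cGv : continuous (fun x : 'rV[R]_n => G (x + v)).
  exact: continuous_row_shift.
have mG : measurable_fun setT (EFin \o G).
  by apply/measurable_EFinP; exact: continuous_row_measurable.
have Goo : (\int[lebesgue_row n]_x (G x)%:E < +oo)%E.
  apply: le_lt_trans goo; apply: ge0_le_integral => //.
    by move=> x _; rewrite lee_fin.
    apply/measurable_EFinP; apply: continuous_row_measurable.
    exact: continuous_row_expRN.
  move=> x _; rewrite lee_fin ger_pMr ?expR_gt0 // invf_le1.
    by rewrite lerDl expR_ge0.
  by rewrite addr_gt0 // expR_gt0.
have GD x : G x <= G (x + v).
  apply: ler_pM; [exact: expR_ge0|exact: ltW| |exact: ltW].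
  by rewrite ler_expR lerN2.
have := @eq_continuous_of_integral R n G (fun x => G (x + v)) cG cGv.
move=> /(_ _ Goo) GE.
have /(congr1 (fun h => h 0)) : G = (fun x => G (x + v)).
  apply: GE => [x|]; first by rewrite G0 GD.
  by rewrite (@ge0_integral_lebesgue_row_shift R n v (EFin \o G)).
apply/eqP; rewrite lt_eqF // /G.
apply: (@lt_le_trans _ _ (expR (- g 0) * phi (0 + v))).
  by rewrite ltr_pM2l ?expR_gt0.
by rewrite ler_pM2r // ler_expR lerN2.
Qed.

(** * Slices of constant mass are translates of each other *)

(** The recession direction (v, tau) has tau > 0 since a horizontal one would
    contradict the integrability of the slice t = 1. With c = v / tau it says
    that f (y + t c, t) <= f (y, 0), and equality of the two masses turns this
    into an equality. *)
Lemma translation_of_constant_mass (R : realType) (n : nat)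
    (f : 'rV[R]_n * R^o -> R) (Z : R) : 0 < Z ->
  convex_on (upper_half R n) f ->
  (forall t, 0 <= t ->
     (\int[lebesgue_row n]_x (expR (- f (x, t)))%:E)%E = Z%:E) ->
  exists c : 'rV[R]_n, forall x (t : R), 0 <= t -> f (x, t) = f (x - t *: c, 0).
Proof.
move=> Z0 cf fZ.
have cft t : 0 <= t -> continuous (fun x => f (x, t)).
  move=> t0; apply: convex_on_row_continuous.
  exact: convex_on_upper_half_slice.
have [p_ hp] := boolp.choice (slow_growth_of_mass Z0 cft fZ).
have [|||[v tau] [q0 /= tau0 rec]] := convex_on_recession (p_ := p_) cf.
- by move=> k; have [] := hp k.
- by move=> k; have [] := hp k.
- by move=> k; have [] := hp k.
have [tau_eq0|tau_neq0] := eqVneq tau 0.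
  exfalso; have v0 : v != 0.
    by apply: contra_neq q0 => ->; rewrite tau_eq0.
  apply: (no_recession_of_integrable (cft 1 ler01) v0).
    by rewrite fZ // ltry.
  move=> x; have := rec (x, 1) 1 ler01 ler01.
  rewrite tau_eq0 mulr0 addr0 => /(_ ltr01); congr (f (_, _) <= _).
    by rewrite /= scale1r.
  by rewrite /= scaler0 addr0.
have taup : 0 < tau by rewrite lt_neqAle eq_sym tau_neq0.
exists (tau^-1 *: v) => x t; rewrite le_eqVlt => /orP[/eqP<-|t0].
  by rewrite scale0r subr0.
pose w := t *: (tau^-1 *: v).
have fw y : f (y + w, t) <= f (y, 0).
  have := rec (y, 0) (t / tau) (lexx 0) (divr_ge0 (ltW t0) tau0).
  rewrite /= divfK // add0r => /(_ t0); congr (f (_, _) <= _) => /=.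
    by rewrite /w scalerA.
  by rewrite add0r; apply: divfK.
have cexp s : 0 <= s -> continuous (fun y => expR (- f (y, s))).
  by move=> s0; apply: continuous_row_expRN; exact: cft.
have ce0 := cexp 0 (lexx 0); have cet := cexp t (ltW t0).
have cew := continuous_row_shift (v := w) cet.
have := eq_continuous_of_integral ce0 cew.
have -> : (\int[lebesgue_row n]_y (expR (- f (y + w, t)))%:E = Z%:E)%E.
  rewrite -(fZ t (ltW t0)).
  apply: (@ge0_integral_lebesgue_row_shift R n w
    (fun y => (expR (- f (y, t)))%:E)) => //.
  by apply/measurable_EFinP; exact: continuous_row_measurable.
rewrite fZ // ltry lexx => /(_ _ isT isT) fE.
have /(congr1 (fun h => h (x - w))) : (fun y => expR (- f (y, 0))) =
    (fun y => expR (- f (y + w, t))).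
  by apply: fE => y; rewrite expR_ge0 ler_expR lerN2 fw.
by move=> /expR_inj/oppr_inj; rewrite subrK => ->.
Qed.

Theorem proposition5p6 (R : realType) (n : nat)
    (V : 'rV[R]_n * R^o -> R^o) (b : R)
    (convexV : convex_function ([set: 'rV[R]_n] `*` [set t : R | 0 <= t]) V)
    (Z_pos_fin : forall t : R, 0 <= t ->
       (0 < partition_function V t < +oo)%E)
    (logZ : forall t : R, 0 <= t ->
       - ln (fine (partition_function V t)) =
       - ln (fine (partition_function V 0)) + b * t) :
  exists c : 'rV[R]_n, forall (x : 'rV[R]_n) (t : R), 0 <= t ->
    V (x, t) = V (x - t *: c, 0) + b * t.
Proof.
have Zfin t : 0 <= t -> partition_function V t \is a fin_num.
  by move=> /Z_pos_fin/andP[? ?]; rewrite ge0_fin_numE // ltW.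
have Zpos t : 0 <= t -> 0 < fine (partition_function V t).
  by move=> t0; apply: fine_gt0; exact: Z_pos_fin.
(* Removing the linear drift b t makes the mass of every slice equal to Z 0. *)
pose f (p : 'rV[R]_n * R^o) : R := V p - b * p.2.
have cf : convex_on (upper_half R n) f.
  move=> p q a Dp Dq a01; have := convex_functionW convexV Dp Dq a01.
  rewrite /f /= => h.
  have -> : a *: p.2 + (1 - a) *: q.2 = a * p.2 + (1 - a) * q.2 by [].
  lra.
have [|c fc] := @translation_of_constant_mass R n f _ (Zpos 0 (lexx 0)) cf.
  move=> t t0.
  have -> : fine (partition_function V 0) =
      expR (b * t) * fine (partition_function V t).
    rewrite -[fine (partition_function V t)]lnK ?posrE ?Zpos // -expRD.
    rewrite -[LHS]lnK ?posrE ?Zpos //; congr expR; have := logZ t t0; lra.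
  rewrite EFinM fineK ?Zfin //.
  rewrite -ge0_integralZl ?lee_fin ?expR_ge0 //; last first.
    apply/measurable_EFinP; apply: continuous_row_measurable.
    apply: continuous_row_expRN; apply: convex_on_row_continuous.
    exact: (convex_on_upper_half_slice (convex_functionW convexV)).
  apply: eq_integral => x _; rewrite -EFinM -expRD; do 2 congr (_ _).
  by rewrite /f /= opprB.
exists c => x t t0; have := fc x t t0; rewrite /f /= mulr0 subr0 => <-.
by rewrite subrK.
Qed.
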